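(* Let $P\subseteq W=\mathbb{R}^d$ be a $d$-polytope. Then all the identities $\mathrm{ID}(P;\mathcal{C})$ with $\mathcal{C}\in\tilde{\mathcal{C}}_0(P)$ are implied by the identities $\mathrm{ID}(P;\mathcal{C})$ where $\mathcal{C}$ is a minimal element of the poset $(\tilde{\mathcal{A}}_0(P),\preceq)$; that is, if $\prod_{F\in\mathcal{C}}([P]-[F])=0$ in $M(\mathcal{P}(W))$ for every minimal element $\mathcal{C}$ of $(\tilde{\mathcal{A}}_0(P),\preceq)$, then $\prod_{F\in\mathcal{C}}([P]-[F])=0$ in $M(\mathcal{P}(W))$ for every $\mathcal{C}\in\tilde{\mathcal{C}}_0(P)$.
   Context: For $S\subseteq W=\mathbb{R}^d$, $[S]:W\to\mathbb{C}$ denotes its indicator function. $M(\mathcal{P}(W))$ is the complex vector space of functions on $W$ spanned by indicator functions of closed convex polyhedra, a commutative $\mathbb{C}$-algebra with the well-defined bilinear product determined by $[A]\cdot[B]=[A+B]$ (Minkowski sum) for nonempty closed convex polyhedra, with unit $[\{0\}]$. For a polytope $P$, let $\mathcal{F}(P)$ be the set of its nonempty proper faces, and let $\tilde{\mathcal{C}}_0(P)$ be the collection of all $\mathcal{C}\subseteq\mathcal{F}(P)$ such that every vertex of $P$ lies in some member of $\mathcal{C}$. For $\mathcal{C}\in\tilde{\mathcal{C}}_0(P)$, $\mathrm{ID}(P;\mathcal{C})$ denotes the identity $\prod_{F\in\mathcal{C}}([P]-[F])=0$ in $M(\mathcal{P}(W))$. Let $\tilde{\mathcal{A}}_0(P)\subseteq\tilde{\mathcal{C}}_0(P)$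 be the set of those $\mathcal{C}\in\tilde{\mathcal{C}}_0(P)$ that are minimal with respect to inclusion (these are necessarily antichains of faces). For $\mathcal{A},\mathcal{A}'\in\tilde{\mathcal{A}}_0(P)$, say $\mathcal{A}'$ covers $\mathcal{A}$ if there are a face $A\in\mathcal{A}$ and a set $\mathcal{B}\in\tilde{\mathcal{C}}_0(A)$ with $\mathcal{A}'=(\mathcal{A}\setminus\{A\})\cup\mathcal{B}$. The partial order $\preceq$ on $\tilde{\mathcal{A}}_0(P)$ is: $\mathcal{A}\preceq\mathcal{A}'$ if there is a finite sequence $\mathcal{A}=\mathcal{A}_0,\mathcal{A}_1,\dots,\mathcal{A}_k=\mathcal{A}'$ ($k\ge0$) such that each $\mathcal{A}_{i+1}$ covers $\mathcal{A}_i$. *)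

(* Defs.v *)
From HB Require Import structures.
From mathcomp Require Import all_boot all_order all_algebra.
From mathcomp Require Import ring lra.
From mathcomp Require Import complex.
From mathcomp Require Import finmap.
From mathcomp Require Import all_classical all_reals numfun.

Set Implicit Arguments.
Unset Strict Implicit.
Unset Printing Implicit Defensive.

Import Order.TTheory GRing.Theory Num.Theory.

Local Open Scope classical_set_scope.
Local Open Scope ring_scope.

Definition dotv (R : realType) (d : nat) (c x : 'rV[R]_d) : R :=
  \sum_i c 0 i * x 0 i.

(* Finite intersections of closed half-spaces; set0 and setT are included. *)
Definition polyhedral (R : realType) (d : nat) (A : set 'rV[R]_d) : Prop :=
  exists s : seq ('rV[R]_d * R),
    A = [set x | forall h, h \in s -> dotv h.1 x <= h.2].

Definition minkowski (R : realType) (d : nat) (A B : set 'rV[R]_d)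
    : set 'rV[R]_d :=
  [set x + y | x in A & y in B].

Lemma mem_asbool T (A : set T) x : (x \in A) = `[< A x >].
Proof. by apply/idP/asboolP; rewrite in_setE. Qed.

Section Dot.
Context {R : realType}.

Lemma dotvE d (c x : 'rV[R]_d) : dotv c x = (x *m c^T) 0 0.
Proof. by rewrite mxE; apply: eq_bigr => i _; rewrite mxE mulrC. Qed.

Lemma dotvD d (c x y : 'rV[R]_d) : dotv c (x + y) = dotv c x + dotv c y.
Proof. by rewrite !dotvE mulmxDl mxE. Qed.

Lemma dotvZ d (c x : 'rV[R]_d) t : dotv c (t *: x) = t * dotv c x.
Proof. by rewrite !dotvE -scalemxAl mxE. Qed.

Lemma dotvDl d (b c x : 'rV[R]_d) : dotv (b + c) x = dotv b x + dotv c x.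
Proof. by rewrite !dotvE linearD/= mulmxDr mxE. Qed.

Lemma dotvZl d (c x : 'rV[R]_d) t : dotv (t *: c) x = t * dotv c x.
Proof. by rewrite !dotvE linearZ/= -scalemxAr mxE. Qed.

Lemma dotv_mul d e (c : 'rV[R]_e) (x : 'rV[R]_d) (F : 'M_(d, e)) :
  dotv c (x *m F) = dotv (c *m F^T) x.
Proof. by rewrite !dotvE trmx_mul trmxK mulmxA. Qed.

Lemma dotv_delta d (x : 'rV[R]_d) i : dotv (delta_mx 0 i) x = x 0 i.
Proof.
rewrite /dotv (bigD1 i)//= big1 ?addr0 ?mxE ?eqxx ?mul1r// => j ji.
by rewrite mxE eqxx (negbTE ji) mul0r.
Qed.

End Dot.

Section Fourier_Motzkin.
Context {R : realType}.

Lemma between (L U : seq R) :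
  (forall l u, l \in L -> u \in U -> l <= u) ->
  exists t, (forall l, l \in L -> l <= t) /\ (forall u, u \in U -> t <= u).
Proof.
elim: L => [|l L IH] LU.
  elim: U {LU} => [|u U [t [_ tU]]]; first by exists 0.
  exists (Num.min t u); split => // v; rewrite inE => /predU1P[->|/tU tv].
    by rewrite ge_min lexx orbT.
  by rewrite ge_min tv.
have [|t [tL tU]] := IH.
  by move=> l' u l'L uU; apply: LU => //; rewrite inE l'L orbT.
exists (Num.max t l); split => [l'|u uU].
  rewrite inE => /predU1P[->|/tL l't]; first by rewrite le_max lexx orbT.
  by rewrite le_max l't.
by rewrite ge_max tU//= LU// inE eqxx.
Qed.

(* Fourier-Motzkin elimination, along an arbitrary direction v *)
Lemma polyhedral_cyl d (v : 'rV[R]_d) A :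
  polyhedral A -> polyhedral [set x | exists t, A (x + t *: v)].
Proof.
move=> [s ->].
pose e (h : 'rV[R]_d * R) := dotv h.1 v.
pose sn := [seq h <- s | e h < 0]; pose sp := [seq h <- s | 0 < e h].
pose comb (g h : 'rV[R]_d * R) : 'rV[R]_d * R :=
  (e h *: g.1 + (- e g) *: h.1, e h * g.2 - e g * h.2).
exists ([seq h <- s | e h == 0] ++ [seq comb g h | g <- sn, h <- sp]).
apply/seteqP; split => x /=.
  move=> [t xt] h; rewrite mem_cat => /orP[|/allpairsP[[g k]/=]].
    rewrite mem_filter => /andP[/eqP eh hs].
    by have := xt h hs; rewrite dotvD dotvZ -/(e h) eh mulr0 addr0.
  rewrite !mem_filter => -[/andP[eg gs] /andP[ek ks] ->{h}] /=.
  have := xt g gs; have := xt k ks; rewrite !dotvD !dotvZ -/(e g) -/(e k).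
  rewrite dotvDl !dotvZl; nra.
move=> xs.
pose w h := (h.2 - dotv h.1 x) / e h.
have [l u|t [tL tU]] := @between (map w sn) (map w sp).
  move=> /mapP[g gs ->] /mapP[k ks ->].
  have := xs (comb g k); rewrite mem_cat => /(_ _)/wrap[].
    by apply/orP; right; apply/allpairsP; exists (g, k).
  move: gs ks; rewrite !mem_filter => /andP[eg _] /andP[ek _].
  rewrite /= dotvDl !dotvZl /w ler_pdivlMr// mulrAC ler_ndivrMr//; nra.
exists t => h hs; rewrite dotvD dotvZ -/(e h).
have [eh|eh|eh] := ltgtP (e h) 0.
- have : w h <= t by apply: tL; apply: map_f; rewrite mem_filter eh.
  rewrite /w ler_ndivrMr//; lra.
- have : t <= w h by apply: tU; apply: map_f; rewrite mem_filter eh.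
  rewrite /w ler_pdivlMr//; lra.
- rewrite eh mulr0 addr0; apply: xs.
  by rewrite mem_cat mem_filter eh eqxx hs.
Qed.

Lemma polyhedralI d (A B : set 'rV[R]_d) :
  polyhedral A -> polyhedral B -> polyhedral (A `&` B).
Proof.
move=> [s ->] [t ->]; exists (s ++ t); apply/seteqP; split => x /=.
  by move=> [xs xt] h; rewrite mem_cat => /orP[/xs|/xt].
by move=> xst; split => h hs; apply: xst; rewrite mem_cat hs ?orbT.
Qed.

Lemma polyhedral_halfspace d (c : 'rV[R]_d) b :
  polyhedral [set x | dotv c x <= b].
Proof.
exists [:: (c, b)]; apply/seteqP; split => x /= xc.
  by move=> h; rewrite inE => /eqP ->.
by apply: (xc (c, b)); rewrite inE.
Qed.

Lemma polyhedral_hyperplane d (c : 'rV[R]_d) b :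
  polyhedral [set x | dotv c x = b].
Proof.
rewrite [X in polyhedral X](_ : _ =
    [set x | dotv c x <= b] `&` [set x | dotv ((-1) *: c) x <= - b]).
  by apply: polyhedralI; apply: polyhedral_halfspace.
apply/seteqP; split => x /=; rewrite dotvZl mulN1r lerN2.
  by move=> ->; rewrite lexx.
by move=> [xb bx]; apply/eqP; rewrite eq_le xb bx.
Qed.

Lemma polyhedralT d : polyhedral [set: 'rV[R]_d].
Proof. by exists [::]; apply/seteqP; split. Qed.

Lemma polyhedral_all d (I : finType) (A : I -> set 'rV[R]_d) :
  (forall i, polyhedral (A i)) -> polyhedral [set x | forall i, A i x].
Proof.
move=> pA; rewrite [X in polyhedral X](_ : _ =
    [set x | forall i, i \in enum I -> A i x]); last first.
  by apply/seteqP; split => x /= Ax i; [move=> _; apply: Ax|apply/Ax/mem_enum].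
elim: (enum I) => [|i s IH].
  by rewrite [X in polyhedral X](_ : _ = setT); [exact: polyhedralT|exact/seteqP].
rewrite [X in polyhedral X](_ : _ =
   A i `&` [set x | forall i, i \in s -> A i x]); first exact: polyhedralI.
apply/seteqP; split => x /=.
  move=> Ax; split; first by apply: Ax; rewrite inE eqxx.
  by move=> j js; apply: Ax; rewrite inE js orbT.
by move=> [Ai As] j; rewrite inE => /predU1P[->|/As].
Qed.

Lemma polyhedral_preimage d e (F : 'M[R]_(d, e)) A :
  polyhedral A -> polyhedral [set x | A (x *m F)].
Proof.
move=> [s ->]; exists [seq (h.1 *m F^T, h.2) | h <- s].
apply/seteqP; split => x /= xs.
  by move=> _ /mapP[h hs ->] /=; rewrite -dotv_mul; apply: xs.
by move=> h hs; rewrite dotv_mul; apply: (xs (_, _)); apply: (map_f _ hs).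
Qed.

Lemma polyhedral_eq d e (F : 'M[R]_(d, e)) : polyhedral [set x | x *m F = 0].
Proof.
rewrite [X in polyhedral X](_ : _ =
    [set x | forall i, dotv (delta_mx 0 i) (x *m F) = 0]).
  apply: polyhedral_all => i.
  exact: (@polyhedral_preimage _ _ F [set y | dotv _ y = 0]
            (polyhedral_hyperplane _ _)).
apply/seteqP; split => x /= xF.
  by move=> i; rewrite xF dotv_delta mxE.
by apply/rowP => i; rewrite -dotv_delta xF mxE.
Qed.

Lemma polyhedral_cyls d k (v : 'I_k -> 'rV[R]_d) A :
  polyhedral A ->
  polyhedral [set x | exists u : 'I_k -> R, A (x + \sum_i u i *: v i)].
Proof.
elim: k v A => [|k IH] v A pA.
  rewrite [X in polyhedral X](_ : _ = A)//; apply/seteqP; split => x /=.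
    by move=> [u]; rewrite big_ord0 addr0.
  by move=> Ax; exists (fun=> 0); rewrite big_ord0 addr0.
have pA' := polyhedral_cyl (v ord0) pA.
have := IH (fun i => v (lift ord0 i)) _ pA'.
set B := (X in polyhedral X -> _); set B' := (X in _ -> polyhedral X).
suff -> : B = B' by [].
apply/seteqP; split => x /=.
  move=> [u [t Ax]]; exists (fun i => if unlift ord0 i is Some j then u j else t).
  rewrite big_ord_recl unlift_none (addrC (t *: _)) addrA.
  by under eq_bigr do rewrite liftK.
move=> [u]; rewrite big_ord_recl (addrC (u _ *: _)) addrA => Ax.
by exists (fun i => u (lift ord0 i)), (u ord0).
Qed.

Lemma polyhedral_image d e (F : 'M[R]_(d, e)) A :
  polyhedral A -> polyhedral [set x *m F | x in A].
Proof.
move=> pA.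
pose G : 'M[R]_(d + e, e) := col_mx F (- 1%:M).
pose B := [set z : 'rV[R]_(d + e) | A (z *m col_mx 1%:M 0)] `&`
          [set z | z *m G = 0].
have pB : polyhedral B.
  by apply: polyhedralI; [exact: polyhedral_preimage|exact: polyhedral_eq].
have pB' := polyhedral_cyls (fun i : 'I_d => row_mx (delta_mx 0 i) 0) pB.
have := polyhedral_preimage (row_mx (0 : 'M_(e, d)) 1%:M) pB'.
set P := (X in polyhedral X -> _); set Q := (X in _ -> polyhedral X).
suff -> : P = Q by [].
have sumE (u : 'I_d -> R) :
    \sum_i u i *: row_mx (delta_mx 0 i) (0 : 'rV_e) = row_mx (\row_i u i) 0.
  have -> : row_mx (\row_i u i) (0 : 'rV[R]_e) =
            (\row_i u i) *m row_mx 1%:M (0 : 'M_(d, e)).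
    by rewrite mul_mx_row mulmx1 mulmx0.
  rewrite mulmx_sum_row; apply: eq_bigr => i _.
  by rewrite mxE rowE mul_mx_row mulmx1 mulmx0.
have BE (y : 'rV[R]_e) x : B (y *m row_mx 0 1%:M + row_mx x 0) <->
    A x /\ x *m F = y.
  rewrite /B/= mul_mx_row mulmx0 mulmx1 add_row_mx add0r addr0 !mul_row_col.
  rewrite mulmx1 mulmx0 addr0 mulmxN mulmx1; split => -[Ax].
    by move=> /eqP; rewrite subr_eq0 => /eqP.
  by move=> ->; rewrite subrr.
apply/seteqP; split => y /=.
  move=> [u]; rewrite sumE => /BE[Ax <-].
  by exists (\row_i u i).
move=> [x Ax xy]; exists (fun i => x 0 i); rewrite sumE; apply/BE.
by have -> : \row_i x 0 i = x by apply/rowP => i; rewrite mxE.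
Qed.

Lemma polyhedral_minkowski d (A B : set 'rV[R]_d) :
  polyhedral A -> polyhedral B -> polyhedral (minkowski A B).
Proof.
move=> pA pB.
have p1 := polyhedral_preimage (col_mx 1%:M 0 : 'M_(d + d, d)) pA.
have p2 := polyhedral_preimage (col_mx 0 1%:M : 'M_(d + d, d)) pB.
have := polyhedral_image (col_mx 1%:M 1%:M : 'M_(d + d, d)) (polyhedralI p1 p2).
set P := (X in polyhedral X -> _).
suff -> : P = minkowski A B by [].
apply/seteqP; split => x /=.
  move=> [z []/=]; rewrite -(hsubmxK z) !mul_row_col !mulmx1 !mulmx0 addr0 add0r.
  by move=> Az Bz <-; exists (lsubmx z) => //; exists (rsubmx z).
move=> [a Aa [b Bb <-]]; exists (row_mx a b).
  by rewrite /= !mul_row_col !mulmx1 !mulmx0 addr0 add0r.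
by rewrite mul_row_col !mulmx1.
Qed.

End Fourier_Motzkin.

Section Euler.
Context {R : realType}.
Implicit Types s : seq (R * R).

Definition sat1 s t := all (fun c => c.1 * t <= c.2) s.

Lemma sat1_shape s : (forall t, sat1 s t = false) \/
  exists lo hi : option R, [/\
    forall t, sat1 s t = (if lo is Some l then l <= t else true) &&
                         (if hi is Some u then t <= u else true),
    is_true (if lo is Some l then l \in [seq c.2 / c.1 | c <- s] else true),
    is_true (if hi is Some u then u \in [seq c.2 / c.1 | c <- s] else true) &
    is_true (if lo is Some l then if hi is Some u then l <= u else true else true)].
Proof.
elim: s => [|[e b] s [IH|[lo [hi [IH ilo ihi lohi]]]]].
- by right; exists None, None; split.
- by left => t; rewrite /= IH andbF.
have mem_s (o : option R) : is_true (if o is Some l then l \in [seq c.2 / c.1 | c <- s]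
    else true) -> is_true (if o is Some l then l \in [seq c.2 / c.1 | c <- (e, b) :: s]
    else true).
  by case: o => // l ls; rewrite inE ls orbT.
have [e0|e0|e0] := ltgtP e 0.
- have E t : e * t <= b = (b / e <= t) by rewrite ler_ndivrMr// mulrC.
  pose lo' := if lo is Some l then Num.max (b / e) l else b / e.
  have ilo' : lo' \in [seq c.2 / c.1 | c <- (e, b) :: s].
    rewrite /lo'; case: lo ilo {IH lo' lohi} => [l|] ls; rewrite inE ?eqxx//=.
    by case: leP; rewrite ?eqxx ?ls ?orbT.
  have E' t : sat1 ((e, b) :: s) t = (lo' <= t) &&
      (if hi is Some u then t <= u else true).
    rewrite /= IH E andbA; congr andb; rewrite /lo'.
    by case: (lo) => [l|]; rewrite ?andbT// ge_max.
  case: hi {IH} ihi lohi E' => [u|] ihi lohi E'; last first.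
    by right; exists (Some lo'), None; split.
  have [lu|ul] := leP lo' u.
    by right; exists (Some lo'), (Some u); split => //; exact: (mem_s (Some u)).
  left => t; rewrite E'; apply/negP => /andP[a1 a2].
  by have := lt_le_trans ul (le_trans a1 a2); rewrite ltxx.
- have E t : e * t <= b = (t <= b / e) by rewrite ler_pdivlMr// mulrC.
  pose hi' := if hi is Some u then Num.min (b / e) u else b / e.
  have ihi' : hi' \in [seq c.2 / c.1 | c <- (e, b) :: s].
    rewrite /hi'; case: hi ihi {IH hi' lohi} => [l|] ls; rewrite inE ?eqxx//=.
    by case: leP; rewrite ?eqxx ?ls ?orbT.
  have E' t : sat1 ((e, b) :: s) t =
      (if lo is Some l then l <= t else true) && (t <= hi').
    rewrite /= IH E andbCA; congr andb; rewrite /hi'.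
    by case: (hi) => [l|]; rewrite ?andbT// le_min.
  case: lo {IH} ilo lohi E' => [u|] ilo lohi E'; last first.
    by right; exists None, (Some hi'); split.
  have [lu|ul] := leP u hi'.
    by right; exists (Some u), (Some hi'); split => //; exact: (mem_s (Some u)).
  left => t; rewrite E'; apply/negP => /andP[a1 a2].
  by have := lt_le_trans ul (le_trans a1 a2); rewrite ltxx.
- have [b0|b0] := leP 0 b; last first.
    by left => t; rewrite /= e0 mul0r leNgt b0.
  right; exists lo, hi; split; [|exact: (mem_s lo)|exact: (mem_s hi)|by []].
  by move=> t; rewrite /= e0 mul0r b0 /= IH.
Qed.

Lemma small_gap (s : seq (R * R)) :
  exists2 e, 0 < e & forall q, q \in s -> q.1 < q.2 -> q.1 < q.2 - e.
Proof.
elim: s => [|q s [e e0 IH]]; first by exists 1.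
have [q12|q21] := ltP q.1 q.2; last first.
  exists e => // q'; rewrite inE => /predU1P[->|/IH//].
  by rewrite ltNge q21.
exists (Num.min e ((q.2 - q.1) / 2)).
  by rewrite lt_min e0/= divr_gt0// subr_gt0.
move=> q'; rewrite inE => /predU1P[->|q's].
  move=> _; have : Num.min e ((q.2 - q.1) / 2) <= (q.2 - q.1) / 2.
    by rewrite ge_min lexx orbT.
  lra.
move=> /(IH _ q's) lt; apply: lt_le_trans lt _.
by rewrite lerD2l lerN2 ge_min lexx.
Qed.

Lemma lower_bound (s : seq R) : exists b, forall q, q \in s -> b < q.
Proof.
elim: s => [|q s [b IH]]; first by exists 0.
exists (Num.min b (q - 1)) => q'; rewrite inE => /predU1P[->|/IH lt].
  by rewrite gt_min [X in _ || X](_ : _ = true) ?orbT//; lra.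
by rewrite gt_min lt.
Qed.

Lemma euler1 (r : seq (R[i] * seq (R * R))) :
  (forall t, \sum_(p <- r) p.1 * (sat1 p.2 t)%:R = 0) ->
  \sum_(p <- r) p.1 * (`[< exists t, sat1 p.2 t >])%:R = 0.
Proof.
move=> r0.
pose T := undup (flatten [seq [seq c.2 / c.1 | c <- p.2] | p <- r]).
have [e e0 eT] := small_gap [seq (x, y) | x <- T, y <- T].
have {}eT x y : x \in T -> y \in T -> x < y -> x < y - e.
  by move=> xT yT; apply: (eT (x, y)); apply/allpairsP; exists (x, y).
have [b bT] := lower_bound T.
have key p : p \in r -> (`[< exists t, sat1 p.2 t >])%:R =
    (sat1 p.2 b)%:R + \sum_(t <- T)
      ((sat1 p.2 t)%:R - (sat1 p.2 (t - e))%:R) :> R[i].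
  move=> pr.
  have pT x : x \in [seq c.2 / c.1 | c <- p.2] -> x \in T.
    move=> xp; rewrite mem_undup; apply/flattenP.
    by exists [seq c.2 / c.1 | c <- p.2] => //; exact: map_f.
  have [E|[lo [hi [E ilo ihi lohi]]]] := sat1_shape p.2.
    rewrite asboolF; last by move=> [t]; rewrite E.
    by rewrite E add0r big1// => t _; rewrite !E subrr.
  have same t : t \in T -> (forall l, lo = Some l -> t <> l) ->
      sat1 p.2 t = sat1 p.2 (t - e).
    move=> tT tl; rewrite !E; congr andb.
      case: lo ilo tl {E lohi} => // l /pT lT /(_ l erefl)/eqP tl.
      have [lt|lt|lt] := ltgtP l t; last by rewrite lt eqxx in tl.
        by rewrite ltW// eT.
      by symmetry; apply/negbTE; rewrite -ltNge; lra.
    case: hi ihi {E lohi} => // u /pT uT.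
    have [tu|ut] := leP t u; first by rewrite (le_trans _ tu)//; lra.
    by symmetry; apply/negbTE; rewrite -ltNge eT.
  case: lo ilo E lohi same => [l|] ilo E lohi same.
    have sl : sat1 p.2 l by rewrite E lexx; case: (hi) lohi.
    rewrite asboolT; last by exists l.
    rewrite (bigD1_seq l) ?undup_uniq ?pT//= sl.
    rewrite big_seq_cond big1 ?addr0; last first.
      move=> t /andP[tT tl]; rewrite same ?subrr//.
      by move=> _ [<-]; exact/eqP.
    have -> : sat1 p.2 (l - e) = false.
      by apply/negbTE; rewrite E negb_and -ltNge; apply/orP; left; lra.
    have -> : sat1 p.2 b = false.
      by apply/negbTE; rewrite E negb_and -ltNge bT ?pT.
    by rewrite subr0 add0r.
  have sb : sat1 p.2 b.
    by rewrite E/=; case: (hi) ihi => // u /pT/bT/ltW.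
  rewrite asboolT; last by exists b.
  by rewrite sb big_seq big1 ?addr0// => t tT; rewrite same ?subrr.
rewrite big_seq; under eq_bigr => p pr do rewrite key// mulrDr mulr_sumr.
rewrite -big_seq big_split/= r0 add0r exchange_big/= big1// => t _.
by under eq_bigr do rewrite mulrBr; rewrite sumrB !r0 subrr.
Qed.

Lemma euler_cyl d (v : 'rV[R]_d) (r : seq (R[i] * set 'rV[R]_d)) :
  (forall p, p \in r -> polyhedral p.2) ->
  (forall x, \sum_(p <- r) p.1 * \1_p.2 x = 0) ->
  forall x, \sum_(p <- r) p.1 * \1_[set x | exists t, p.2 (x + t *: v)] x = 0.
Proof.
move=> pr r0 x.
have [f fE] : exists f : set 'rV[R]_d -> seq (R * R), forall p, p \in r ->
    forall t, sat1 (f p.2) t = `[< p.2 (x + t *: v) >].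
  suff /choice [f fE] : forall A : set 'rV[R]_d, exists s, polyhedral A ->
      forall t, sat1 s t = `[< A (x + t *: v) >].
    by exists f => p ppr t; apply: fE; exact: pr.
  move=> A; have [[s sE]|nA] := pselect (polyhedral A); last by exists [::].
  exists [seq (dotv h.1 v, h.2 - dotv h.1 x) | h <- s] => _ t.
  rewrite /sat1 all_map sE; apply/allP/asboolP => /= H h hs.
    by have := H h hs; rewrite /= dotvD dotvZ; lra.
  by have := H h hs; rewrite /= dotvD dotvZ; lra.
have r1 : \sum_(p <- r) p.1 * (`[< exists t, sat1 (f p.2) t >])%:R = 0.
  have := @euler1 [seq (p.1, f p.2) | p <- r]; rewrite big_map/=; apply => t.
  rewrite big_map -[RHS](r0 (x + t *: v)) big_seq [RHS]big_seq.
  by apply: eq_bigr => p ppr; rewrite indicE/= fE.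
rewrite -[RHS]r1 big_seq [RHS]big_seq; apply: eq_bigr => p ppr.
rewrite indicE; congr (_ * (nat_of_bool _)%:R); rewrite mem_asbool.
by apply: asbool_equiv_eq; split => /= -[t pt]; exists t;
  move: pt; rewrite fE// => /asboolP.
Qed.

Lemma euler_cyls d k (v : 'I_k -> 'rV[R]_d) (r : seq (R[i] * set 'rV[R]_d)) :
  (forall p, p \in r -> polyhedral p.2) ->
  (forall x, \sum_(p <- r) p.1 * \1_p.2 x = 0) ->
  forall x, \sum_(p <- r) p.1 *
    \1_[set x | exists u : 'I_k -> R, p.2 (x + \sum_i u i *: v i)] x = 0.
Proof.
elim: k v r => [|k IH] v r pr r0 x.
  apply: etrans (r0 x); apply: eq_bigr => p _; congr (_ * \1__ _).
  apply/seteqP; split => y /=; first by move=> [u]; rewrite big_ord0 addr0.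
  by move=> py; exists (fun=> 0); rewrite big_ord0 addr0.
pose r' := [seq (p.1, [set x | exists t, p.2 (x + t *: v ord0)]) | p <- r].
have := IH (fun i => v (lift ord0 i)) r' _ _ x; rewrite big_map => IHx.
apply: etrans (IHx _ _).
- apply: eq_bigr => p _; congr (_ * \1__ _); apply/seteqP; split => y /=.
    move=> [u]; rewrite big_ord_recl (addrC (u _ *: _)) addrA => Ax.
    by exists (fun i => u (lift ord0 i)), (u ord0).
  move=> [u [t Ax]]; exists (fun i => if unlift ord0 i is Some j then u j else t).
  rewrite big_ord_recl unlift_none (addrC (t *: _)) addrA.
  by under eq_bigr do rewrite liftK.
- by move=> _ /mapP[p ppr ->]; apply: polyhedral_cyl; exact: pr.
- by move=> y; rewrite big_map; apply: euler_cyl.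
Qed.

Lemma euler d (r : seq (R[i] * set 'rV[R]_d)) :
  (forall p, p \in r -> polyhedral p.2) ->
  (forall x, \sum_(p <- r) p.1 * \1_p.2 x = 0) ->
  \sum_(p <- r) p.1 * (`[< p.2 !=set0 >])%:R = 0.
Proof.
move=> pr r0.
apply: etrans (euler_cyls (fun i => delta_mx 0 i) pr r0 0).
apply: eq_bigr => p _; rewrite indicE; congr (_ * (nat_of_bool _)%:R); rewrite mem_asbool.
apply: asbool_equiv_eq; split => /=.
  by move=> [x px]; exists (fun i => x 0 i); rewrite add0r -row_sum_delta.
by move=> [u]; exists (0 + \sum_i u i *: delta_mx 0 i).
Qed.

Lemma minkowski_sum0 d (r : seq (R[i] * set 'rV[R]_d)) (B : set 'rV[R]_d) :
  (forall p, p \in r -> polyhedral p.2) -> polyhedral B ->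
  (forall x, \sum_(p <- r) p.1 * \1_p.2 x = 0) ->
  forall x, \sum_(p <- r) p.1 * \1_(minkowski p.2 B) x = 0.
Proof.
move=> pr pB r0 x.
have pB' : polyhedral [set y | B (x - y)].
  case: pB => s ->; exists [seq ((-1) *: h.1, h.2 - dotv h.1 x) | h <- s].
  have E h y : dotv h (x - y) = dotv h x - dotv h y.
    by rewrite -scaleN1r dotvD dotvZ mulN1r.
  apply/seteqP; split => y /= H.
    by move=> _ /mapP[h hs ->] /=; have := H h hs; rewrite E dotvZl; lra.
  move=> h hs; have := H (_, _) (map_f _ hs); rewrite E /= dotvZl; lra.
have := @euler _ [seq (p.1, p.2 `&` [set y | B (x - y)]) | p <- r].
rewrite big_map => E.
apply: etrans (E _ _).
- apply: eq_bigr => p _; rewrite indicE; congr (_ * (nat_of_bool _)%:R); rewrite mem_asbool.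
  apply: asbool_equiv_eq; split => /=.
    by move=> [a pa [b Bb <-]]; exists a; split => //=; rewrite addrC addKr.
  by move=> [a [pa Ba]]; exists a => //; exists (x - a) => //; rewrite addrC subrK.
- by move=> _ /mapP[p ppr ->]; apply: polyhedralI => //; exact: pr.
- move=> y; rewrite big_map/=.
  under eq_bigr do rewrite indicI/= mulrA.
  by rewrite -mulr_suml r0 mul0r.
Qed.

End Euler.

Section Minkowski_algebra.
Context {R : realType} {d : nat}.
Local Notation W := 'rV[R]_d.
Local Notation C := R[i].

Record polyhedron := Polyhedron {
  pset :> set W;
  polyhedronP : polyhedral pset }.

HB.instance Definition _ := gen_eqMixin polyhedron.

Definition polycomb (s : seq (C * polyhedron)) : W -> C^o :=
  fun x => \sum_(p <- s) p.1 * \1_p.2 x.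

Definition polycomb_pred : pred (W -> C^o) :=
  fun f => `[< exists s, f = polycomb s >].

(* The elements of M(P(W)), as functions on W *)
Record polyalg := PolyAlg {
  polyalg_val :> W -> C^o;
  _ : polyalg_val \in polycomb_pred }.

HB.instance Definition _ := [isSub for polyalg_val].
HB.instance Definition _ := [Choice of polyalg by <:].

Lemma polycomb_cat s t : polycomb (s ++ t) = polycomb s + polycomb t.
Proof. by apply/funext => x; rewrite /polycomb big_cat. Qed.

Lemma polycombZ a s :
  polycomb [seq (a * p.1, p.2) | p <- s] = a *: polycomb s.
Proof.
apply/funext => x; rewrite /polycomb big_map/= [RHS]mulr_sumr.
by apply: eq_bigr => p _; rewrite mulrA.
Qed.

Lemma polycomb_closed : submod_closed polycomb_pred.
Proof.
split.
  by apply/asboolP; exists [::]; apply/funext => x; rewrite /polycomb big_nil.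
move=> a _ _ /asboolP[s ->] /asboolP[t ->]; apply/asboolP.
by exists ([seq (a * p.1, p.2) | p <- s] ++ t); rewrite polycomb_cat polycombZ.
Qed.

HB.instance Definition _ :=
  GRing.isSubmodClosed.Build C (W -> C^o) polycomb_pred polycomb_closed.
HB.instance Definition _ := [SubChoice_isSubLmodule of polyalg by <:].

Lemma polycombP s : polycomb s \in polycomb_pred.
Proof. by apply/asboolP; exists s. Qed.

Definition polymk s : polyalg := PolyAlg (polycombP s).

Lemma polymk_ex (f : polyalg) : exists s, f = polymk s.
Proof.
by case: f => f fP; have /asboolP[s fs] := fP; exists s; apply: val_inj.
Qed.

Definition polyrep (f : polyalg) : seq (C * polyhedron) :=
  projT1 (cid (polymk_ex f)).

Lemma polyrepK f : polymk (polyrep f) = f.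
Proof. by rewrite /polyrep; case: cid => s /= <-. Qed.

Definition psum (A B : polyhedron) : polyhedron :=
  Polyhedron (polyhedral_minkowski (polyhedronP A) (polyhedronP B)).

Definition mulcomb (s t : seq (C * polyhedron)) : seq (C * polyhedron) :=
  [seq (p.1 * q.1, psum p.2 q.2) | p <- s, q <- t].

(* The bilinear extension of [A].[B] = [A + B]; it does not depend on the
   chosen representatives, by polymulE. *)
Definition polymul (f g : polyalg) : polyalg :=
  polymk (mulcomb (polyrep f) (polyrep g)).

(* [A]; the default value 0 is irrelevant when A is polyhedral, by polyindE. *)
Definition polyind (A : set W) : polyalg := insubd 0 (\1_A : W -> C^o).

Definition polyone : polyalg := polyind [set 0].

Lemma polyind_mk (A : polyhedron) : polyind A = polymk [:: (1, A)].
Proof.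
have E : \1_A = polycomb [:: (1, A)].
  by apply/funext => x; rewrite /polycomb big_seq1/= mul1r.
apply: val_inj; rewrite insubdK//= E; exact: polycombP.
Qed.

Lemma polyindE (A : set W) : polyhedral A -> polyind A = \1_A :> (W -> C^o).
Proof.
move=> pA; rewrite -[A]/(pset (Polyhedron pA)) polyind_mk.
by apply/funext => x; rewrite /= /polycomb big_seq1/= mul1r.
Qed.

Lemma mulcombE s t x : polycomb (mulcomb s t) x =
  \sum_(p <- s) \sum_(q <- t) p.1 * q.1 * \1_(minkowski p.2 q.2) x.
Proof. by rewrite /polycomb big_allpairs_dep. Qed.

Lemma minkowskiC (A B : set W) : minkowski A B = minkowski B A.
Proof.
by apply/seteqP; split => _ [a Aa [b Bb <-]]; exists b => //; exists a => //;
  rewrite addrC.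
Qed.

Lemma minkowskiA (A B D : set W) :
  minkowski A (minkowski B D) = minkowski (minkowski A B) D.
Proof.
apply/seteqP; split => x.
  move=> [a Aa [_ [b Bb [c Dc <-]] <-]]; exists (a + b).
    by exists a => //; exists b.
  by exists c => //; rewrite addrA.
move=> [_ [a Aa [b Bb <-]] [c Dc <-]]; exists a => //; exists (b + c).
  by exists b => //; exists c.
by rewrite addrA.
Qed.

Lemma minkowski0 (A : set W) : minkowski [set 0] A = A.
Proof.
apply/seteqP; split => x; first by move=> [_ -> [a Aa <-]]; rewrite add0r.
by move=> Ax; exists 0 => //; exists x => //; rewrite add0r.
Qed.

Lemma polycomb_mulC s t : polycomb (mulcomb s t) = polycomb (mulcomb t s).
Proof.
apply/funext => x; rewrite !mulcombE exchange_big/=.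
apply: eq_bigr => p _; apply: eq_bigr => q _.
by rewrite minkowskiC (mulrC p.1).
Qed.

Lemma polycomb_mull s s' t : polycomb s = polycomb s' ->
  polycomb (mulcomb s t) = polycomb (mulcomb s' t).
Proof.
move=> ss'; apply/funext => x; rewrite !mulcombE.
rewrite exchange_big [RHS]exchange_big/=; apply: eq_bigr => q _.
pose r : seq (C * set W) := [seq (p.1, pset p.2) | p <- s] ++
  [seq (- p.1, pset p.2) | p <- s'].
have pr p : p \in r -> polyhedral p.2.
  by rewrite mem_cat => /orP[] /mapP[p' _ ->]; apply: polyhedronP.
have r0 y : \sum_(p <- r) p.1 * \1_p.2 y = 0.
  rewrite big_cat !big_map/=; under [X in _ + X]eq_bigr do rewrite mulNr.
  rewrite sumrN; apply/eqP; rewrite subr_eq0; apply/eqP.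
  exact: (congr1 (fun f => f y) ss').
have := minkowski_sum0 pr (polyhedronP q.2) r0 x.
rewrite big_cat !big_map/=; under [X in _ + X]eq_bigr do rewrite mulNr.
rewrite sumrN => /eqP; rewrite subr_eq0 => /eqP E.
under eq_bigr do rewrite (mulrC _ q.1) -mulrA.
by under [RHS]eq_bigr do rewrite (mulrC _ q.1) -mulrA; rewrite -!mulr_sumr E.
Qed.

Lemma polymulE s t : polymul (polymk s) (polymk t) = polymk (mulcomb s t).
Proof.
apply: val_inj => /=.
have E u : polycomb (polyrep (polymk u)) = polycomb u.
  by rewrite -[LHS]/(val (polymk _)) polyrepK.
rewrite (polycomb_mull _ (E s)) polycomb_mulC (polycomb_mull _ (E t)).
exact: polycomb_mulC.
Qed.

Lemma polymkD s t : polymk (s ++ t) = polymk s + polymk t.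
Proof. by apply: val_inj; rewrite /= polycomb_cat. Qed.

Lemma polymkZ a s : polymk [seq (a * p.1, p.2) | p <- s] = a *: polymk s.
Proof. by apply: val_inj; rewrite /= polycombZ. Qed.

Lemma polymulC : commutative polymul.
Proof.
move=> f g; have [s ->] := polymk_ex f; have [t ->] := polymk_ex g.
by rewrite !polymulE; apply: val_inj; exact: polycomb_mulC.
Qed.

Lemma polymulA : associative polymul.
Proof.
move=> f g h; have [s ->] := polymk_ex f; have [t ->] := polymk_ex g.
have [u ->] := polymk_ex h; rewrite !polymulE; apply: val_inj.
apply/funext => x; rewrite /= !mulcombE [RHS]big_allpairs_dep/=.
apply: eq_bigr => p _; rewrite big_allpairs_dep/=.
apply: eq_bigr => q _; apply: eq_bigr => w _.
by rewrite minkowskiA !mulrA.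
Qed.

Lemma polymulDl : left_distributive polymul +%R.
Proof.
move=> f g h; have [s ->] := polymk_ex f; have [t ->] := polymk_ex g.
have [u ->] := polymk_ex h; rewrite -polymkD !polymulE -polymkD.
by rewrite /mulcomb allpairs_cat.
Qed.

Lemma polymulZl a f g : a *: polymul f g = polymul (a *: f) g.
Proof.
have [s ->] := polymk_ex f; have [t ->] := polymk_ex g.
rewrite polymulE -!polymkZ polymulE; apply: val_inj; apply/funext => x /=.
rewrite mulcombE big_map /polycomb big_map big_allpairs_dep/=.
apply: eq_bigr => p _; apply: eq_bigr => q _.
by rewrite !mulrA.
Qed.

Lemma polyhedral0 : polyhedral [set 0 : W].
Proof.
have := polyhedral_eq (1%:M : 'M[R]_d).
rewrite [X in polyhedral X -> _](_ : _ = [set 0])//.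
by apply/seteqP; split => x /=; rewrite mulmx1.
Qed.

Lemma polyoneE : polyone = polymk [:: (1, Polyhedron polyhedral0)].
Proof. exact: (polyind_mk (Polyhedron polyhedral0)). Qed.

Lemma polymul1 : left_id polyone polymul.
Proof.
move=> f; have [s ->] := polymk_ex f.
rewrite polyoneE polymulE; apply: val_inj; apply/funext => x /=.
rewrite mulcombE big_seq1/=; apply: eq_bigr => p _.
by rewrite minkowski0 mul1r.
Qed.

Lemma polyone_neq0 : polyone != 0.
Proof.
apply/eqP => /(congr1 (fun f : polyalg => f 0)).
rewrite polyoneE /= /polycomb big_seq1/= mul1r indicE mem_asbool asboolT//.
by move=> /eqP; rewrite oner_eq0.
Qed.

HB.instance Definition _ := GRing.Zmodule_isComNzRing.Build polyalg
  polymulA polymulC polymul1 polymulDl polyone_neq0.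
HB.instance Definition _ :=
  GRing.Lmodule_isLalgebra.Build C polyalg polymulZl.
HB.instance Definition _ := GRing.Lalgebra_isComAlgebra.Build C polyalg.

Lemma polyindM (A B : set W) : polyhedral A -> polyhedral B ->
  polyind A * polyind B = polyind (minkowski A B).
Proof.
move=> pA pB; rewrite -[A]/(pset (Polyhedron pA)) -[B]/(pset (Polyhedron pB)).
rewrite -[minkowski _ _]/(pset (psum (Polyhedron pA) (Polyhedron pB))).
by rewrite !polyind_mk [LHS]polymulE /mulcomb/= mulr1.
Qed.

End Minkowski_algebra.

Arguments polyalg R d : clear implicits.

Section Polytopes.
Context {R : realType} {d : nat}.
Local Notation W := 'rV[R]_d.
Implicit Types (P F : set W) (C D : set (set W)).

Definition conv_hull (k : nat) (X : 'I_k -> W) : set W :=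
  [set x | exists l : 'I_k -> R,
     [/\ forall i, 0 <= l i, \sum_i l i = 1 & x = \sum_i l i *: X i]].

Definition polytope P : Prop := exists k (X : 'I_k -> W), P = conv_hull X.

Definition affine_hull P : set W :=
  [set x | exists k (X : 'I_k -> W) (l : 'I_k -> R),
     [/\ forall i, P (X i), \sum_i l i = 1 & x = \sum_i l i *: X i]].

Definition has_dim P (k : nat) : Prop :=
  exists (x0 : W) (U : {vspace W}),
    affine_hull P = [set x | x - x0 \in U] /\ \dim U = k.

Definition dim_polytope (k : nat) P : Prop := polytope P /\ has_dim P k.

(* c = 0 makes P and set0 (improper) faces of P. *)
Definition face P F : Prop :=
  exists (c : W) (b : R),
    (forall x, P x -> dotv c x <= b) /\ F = P `&` [set x | dotv c x = b].

Definition vertex P (v : W) : Prop := face P [set v].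

Definition proper_faces P : set (set W) :=
  [set F | [/\ face P F, F !=set0 & F <> P]].

Definition vertex_covers P : set (set (set W)) :=
  [set C | C `<=` proper_faces P /\
           forall v, vertex P v -> exists2 F, C F & F v].

Definition min_vertex_covers P : set (set (set W)) :=
  [set C | vertex_covers P C /\
           forall D, vertex_covers P D -> D `<=` C -> D = C].

(* C' covers C *)
Definition mvc_covers C' C : Prop :=
  exists A D, [/\ C A, vertex_covers A D & C' = (C `\ A) `|` D].

Definition mvc_le P C C' : Prop :=
  exists (k : nat) (s : nat -> set (set W)),
    [/\ s 0%N = C, s k = C',
        forall i, (i <= k)%N -> min_vertex_covers P (s i) &
        forall i, (i < k)%N -> mvc_covers (s i.+1) (s i)].

Definition mvc_minimal P C : Prop :=
  min_vertex_covers P C /\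
  forall D, min_vertex_covers P D -> mvc_le P D C -> D = C.

(* For a polytope P, every C included in proper_faces P is finite, by
   proper_faces_finite, so that fset_set C has the same elements as C. *)
Definition ID P C : Prop :=
  \prod_(F <- fset_set C) (polyind P - polyind F) = 0 :> polyalg R d.

Lemma polytope_polyhedral P : polytope P -> polyhedral P.
Proof.
move=> [k [X ->]].
pose Q := [set l : 'rV[R]_k | forall i, dotv (- delta_mx 0 i) l <= 0] `&`
          [set l | dotv (const_mx 1) l = 1].
have pQ : polyhedral Q.
  apply: polyhedralI; last exact: polyhedral_hyperplane.
  by apply: polyhedral_all => i; exact: polyhedral_halfspace.
have QE l : Q l <-> (forall i, 0 <= l 0 i) /\ \sum_i l 0 i = 1.
  have -> : \sum_i l 0 i = dotv (const_mx 1) l.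
    by apply: eq_bigr => i _; rewrite mxE mul1r.
  by split => -[l0 l1]; split => // i; have := l0 i; rewrite /=;
    rewrite -scaleN1r dotvZl dotv_delta mulN1r oppr_le0.
have := polyhedral_image (\matrix_i X i) pQ.
set A := (X in polyhedral X -> _); suff -> : A = conv_hull X by [].
apply/seteqP; split => x /=.
  move=> [l /QE[l0 l1] <-]; exists (fun i => l 0 i); split => //.
  by rewrite mulmx_sum_row; apply: eq_bigr => i _; rewrite rowK.
move=> [l [l0 l1 ->]]; exists (\row_i l i).
  apply/QE; split => [i|]; first by rewrite mxE.
  by rewrite -[RHS]l1; apply: eq_bigr => i _; rewrite mxE.
by rewrite mulmx_sum_row; apply: eq_bigr => i _; rewrite rowK mxE.
Qed.

Lemma face_polyhedral P F : polyhedral P -> face P F -> polyhedral F.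
Proof.
by move=> pP [c [b [_ ->]]]; apply: polyhedralI => //; exact: polyhedral_hyperplane.
Qed.

Lemma dotv_sum (c : W) k (l : 'I_k -> R) (X : 'I_k -> W) :
  dotv c (\sum_i l i *: X i) = \sum_i l i * dotv c (X i).
Proof.
rewrite dotvE mulmx_suml summxE; apply: eq_bigr => i _.
by rewrite dotvE -scalemxAl mxE.
Qed.

Lemma conv_hull_gen k (X : 'I_k -> W) i : conv_hull X (X i).
Proof.
exists (fun j => (j == i)%:R); split => [j||]; first exact: ler0n.
- by rewrite (bigD1 i)//= eqxx big1 ?addr0// => j /negbTE ->.
- rewrite (bigD1 i)//= eqxx scale1r big1 ?addr0// => j /negbTE ->.
  by rewrite scale0r.
Qed.

Lemma proper_faces_finite P : polytope P -> finite_set (proper_faces P).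
Proof.
move=> [k [X PE]].
pose gens F : {set 'I_k} := finset.finset (fun i => `[< F (X i) >]).
have sub F F' : face P F -> face P F' -> gens F = gens F' -> F `<=` F'.
  move=> [c [b [cb ->]]] [c' [b' [cb' ->]]] FF' x [Px cx]; split => //.
  move: Px cx; rewrite /= {1}PE => -[l [l0 l1 ->]].
  rewrite !dotv_sum => cx.
  have PX i : P (X i) by rewrite PE; exact: conv_hull_gen.
  have cX i : l i != 0 -> dotv c (X i) = b.
    have : \sum_i l i * (b - dotv c (X i)) = 0.
      under eq_bigr do rewrite mulrBr.
      by rewrite sumrB -mulr_suml l1 mul1r cx subrr.
    move=> /eqP; rewrite psumr_eq0 => [|j _]; last first.
      by rewrite mulr_ge0// subr_ge0 cb.
    move=> /allP /(_ i (mem_index_enum i)); rewrite mulf_eq0 => /orP[->//|].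
    by rewrite subr_eq0 => /eqP.
  rewrite -[RHS]mul1r -l1 mulr_suml; apply: eq_bigr => i _.
  have [->|li] := eqVneq (l i) 0; first by rewrite !mul0r.
  have : i \in gens (P `&` [set x | dotv c x = b]).
    by rewrite finset.in_set; apply/asboolP; split; [exact: PX|exact: cX].
  by rewrite FF' finset.in_set => /asboolP[_ ->].
pose f (I : {set 'I_k}) : set W := xget set0 [set F | face P F /\ gens F = I].
apply: (@sub_finite_set _ _ (range f)); last exact: finite_image.
move=> F [fF _ _]; exists (gens F) => //; rewrite /f; case: xgetP => [G _ [fG GF]|].
  by apply/seteqP; split; apply: sub.
by move=> /(_ F) []; split.
Qed.

End Polytopes.

(* Main.v *)
Require Import Defs.
From mathcomp Require Import all_boot all_order all_algebra.
From mathcomp Require Import all_classical all_reals.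
From mathcomp Require Import ring numfun.

(* Write P as the convex hull of its vertices v_i, and let K_i be the cone
   spanned by the v_j - v_i. If v_i lies in the face F then P + K_i = F + K_i,
   so that z = \prod_(F in C) ([P] - [F]) is killed by every [K_i]. Let r_ij be
   the class of the ray spanned by v_j - v_i, so that [K_i] = \prod_j r_ij. Since
   two opposite rays cover a line, (1 - r_ij) (1 - r_ji) = 0, and r_ij r_jk
   absorbs r_ik. Hence r behaves like a total preorder on the vertices; as a
   nonempty finite total preorder has a least element, the [K_i] generate the
   unit ideal, and z = 0. *)

Import Order.TTheory GRing.Theory Num.Theory.

Local Open Scope classical_set_scope.
Local Open Scope ring_scope.

(** * Annihilators indexed by a total preorder in a commutative ring *)

(** Induction on [s], dropping its head [a]: for [i] in the tail, [w], the product of [z] and the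
    remaining [r i j], must vanish. The hypothesis at [i] gives [w * r i a = 0], the one at [a]
    gives [w * r a i = 0], and totality then forces [w = 0]. *)
Lemma total_preorder_annihilator (A : comNzRingType) (I : eqType)
    (r : I -> I -> A) (s : seq I) (z : A) :
  (forall i, r i i = 1) ->
  (forall i j, (1 - r i j) * (1 - r j i) = 0) ->
  (forall i j k, r i j * r j k * r i k = r i j * r j k) ->
  s != [::] ->
  (forall i, i \in s -> z * \prod_(j <- s) r i j = 0) -> z = 0.
Proof.
move=> rr rtot rtrans.
elim: s => // a s IH _ zs.
have za : z * \prod_(j <- s) r a j = 0.
  by have := zs a (mem_head _ _); rewrite big_cons rr mul1r.
have [s0|s0] := eqVneq s [::]; first by move: za; rewrite s0 big_nil mulr1.
apply: IH => // i i_s.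
(* Factor by factor, [r a i * r i j] absorbs [r a j]; the same [r a i] serves for every [j]. *)
have absorb : r a i * \prod_(j <- s) r i j =
    r a i * \prod_(j <- s) r i j * \prod_(j <- s) r a j.
  rewrite -mulrA -big_split/=; elim: (s) => [|j t IHt]; first by rewrite !big_nil.
  by rewrite !big_cons mulrCA IHt mulrCA !mulrA rtrans.
set w := z * _.
have wia : w * r i a = 0.
  have := zs i; rewrite inE i_s orbT => /(_ isT).
  by rewrite big_cons mulrCA mulrC.
have wai : w * r a i = 0.
  by rewrite /w mulrAC -mulrA absorb mulrCA za mulr0.
have : w * ((1 - r i a) * (1 - r a i)) = 0 by rewrite rtot mulr0.
by rewrite mulrA !(mulrBr w) mulr1 wia subr0 mulrBr mulr1 wai subr0.
Qed.

(** * Classes of rays and cones in the Minkowski algebra *)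

Section Rays.
Context {R : realType} {d : nat}.
Local Notation W := 'rV[R]_d.
Implicit Types (u v : W) (s : seq W).

Definition ray u : set W := [set t *: u | t in [set t : R | 0 <= t]].

Fixpoint cone s : set W :=
  if s is u :: s' then minkowski (ray u) (cone s') else [set 0].

Lemma polyhedral_ray u : polyhedral (ray u).
Proof.
(* The ray is the image of the half-line [- x <= 0] of the real line under [u], read as a matrix
   with one row. *)
have := polyhedral_image u (polyhedral_halfspace (- 1 : 'rV[R]_1) 0).
set A := (X in polyhedral X -> _); suff -> : A = ray u by [].
have dE (x : 'rV[R]_1) : dotv (- 1) x = - x 0 0.
  by rewrite /dotv big_ord1 !mxE mulN1r.
apply/seteqP; split => [_ [x + <-]|_ [t /= t0 <-]].
  rewrite /= dE oppr_le0 => x0; exists (x 0 0) => //.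
  by rewrite [in RHS](mx11_scalar x) mul_scalar_mx.
exists t%:M; first by rewrite /= dE oppr_le0 mxE.
by rewrite mul_scalar_mx.
Qed.

Lemma polyhedral_cone s : polyhedral (cone s).
Proof.
elim: s => [|u s IH]; first exact: polyhedral0.
exact: polyhedral_minkowski (polyhedral_ray u) IH.
Qed.

Lemma polyind_cone s : \prod_(u <- s) polyind (ray u) = polyind (cone s).
Proof.
elim: s => [|u s IH]; first by rewrite big_nil.
rewrite big_cons IH polyindM//; first exact: polyhedral_ray.
exact: polyhedral_cone.
Qed.

Lemma mem_ray0 u : ray u 0.
Proof. by exists 0; rewrite /= ?scale0r. Qed.

Lemma ray_zero : ray 0 = [set 0].
Proof.
apply/seteqP; split => [_ [t _ <-]|_ ->]; first by rewrite scaler0.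
by exists 0; rewrite /= ?scale0r.
Qed.

Lemma rayD u (x y : W) : ray u x -> ray u y -> ray u (x + y).
Proof.
move=> [t /= t0 <-] [t' /= t'0 <-]; exists (t + t'); first exact: addr_ge0.
by rewrite scalerDl.
Qed.

Lemma cone0 s : cone s 0.
Proof.
elim: s => //= u s IH; exists 0; first exact: mem_ray0.
by exists 0 => //; rewrite addr0.
Qed.

Lemma coneD s (x y : W) : cone s x -> cone s y -> cone s (x + y).
Proof.
elim: s x y => [|u s IH] x y /=; first by move=> -> ->; rewrite addr0.
move=> [a ua [b sb <-]] [a' ua' [b' sb' <-]]; exists (a + a'); first exact: rayD.
by exists (b + b'); [exact: IH|rewrite addrACA].
Qed.

Lemma cone_sum (I : Type) (e : seq I) (l : I -> R) (f : I -> W) :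
  (forall i, 0 <= l i) -> cone (map f e) (\sum_(i <- e) l i *: f i).
Proof.
move=> l0; elim: e => [|i e IH]; first by rewrite big_nil; exact: cone0.
rewrite big_cons; exists (l i *: f i); first by exists (l i) => //; exact: l0.
by exists (\sum_(j <- e) l j *: f j).
Qed.

Lemma polyindUI (A B : set W) : polyhedral A -> polyhedral B ->
  polyhedral (A `|` B) ->
  polyind A + polyind B = polyind (A `|` B) + polyind (A `&` B).
Proof.
move=> pA pB pAB; apply: val_inj; rewrite !raddfD/= !polyindE//; last first.
  exact: polyhedralI.
apply/funext => x; rewrite !fctE !indicE in_setU in_setI.
by case: (x \in A); case: (x \in B); rewrite /= ?addr0 ?add0r.
Qed.

Lemma ray_oppU u : ray u `|` ray (- u) = minkowski (ray u) (ray (- u)).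
Proof.
apply/seteqP; split => x.
  case=> xu; first by exists x => //; exists 0; [exact: mem_ray0|rewrite addr0].
  by exists 0; [exact: mem_ray0|exists x => //; rewrite add0r].
move=> [_ [t /= t0 <-] [_ [t' /= t'0 <-] <-]].
have [tt|/ltW tt] := leP t' t.
  by left; exists (t - t'); rewrite /= ?subr_ge0// scalerBl -scalerN.
right; exists (t' - t); rewrite /= ?subr_ge0//.
by rewrite scalerN -scaleNr opprB scalerBl scalerN.
Qed.

Lemma ray_oppI u : ray u `&` ray (- u) = [set 0].
Proof.
apply/seteqP; split => [_ [[t /= t0 <-] [t' /= t'0]]|_ ->]; last first.
  by split; exact: mem_ray0.
move=> /eqP; rewrite scalerN eq_sym -subr_eq0 opprK -scalerDl scaler_eq0.
case/orP => [|/eqP ->]; last by rewrite scaler0.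
by rewrite paddr_eq0// => /andP[/eqP -> _]; rewrite scale0r.
Qed.

(** Opposite rays have their Minkowski sum as union and the origin as intersection, so
    inclusion-exclusion reads r + r' = r r' + 1. *)
Lemma ray_opp u :
  (1 - polyind (ray u)) * (1 - polyind (ray (- u))) = 0 :> polyalg R d.
Proof.
have pu := polyhedral_ray u; have pNu := polyhedral_ray (- u).
have := polyindUI _ _ pu pNu; rewrite ray_oppU ray_oppI -polyindM//.
move=> /(_ (polyhedral_minkowski pu pNu)).
rewrite -[polyind [set 0]]/(1 : polyalg R d).
set r := polyind (ray u); set r' := polyind (ray (- u)) => E.
rewrite (_ : _ * _ = r * r' + 1 - (r + r')); first by rewrite E subrr.
by ring.
Qed.

(** The convex cone spanned by [u] and [v] already contains [u + v], so adding that ray does not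
    enlarge it. *)
Lemma ray_trans u v :
  polyind (ray u) * polyind (ray v) * polyind (ray (u + v)) =
  polyind (ray u) * polyind (ray v) :> polyalg R d.
Proof.
have pu := polyhedral_ray u; have pv := polyhedral_ray v.
have puv := polyhedral_ray (u + v).
rewrite !polyindM//; last exact: polyhedral_minkowski.
congr polyind; apply/seteqP; split => x.
  move=> [_ [a ua [b vb <-]] [_ [t t0 <-] <-]].
  exists (a + t *: u); first by apply: rayD => //; exists t.
  exists (b + t *: v); first by apply: rayD => //; exists t.
  by rewrite scalerDr addrACA.
by move=> uvx; exists x => //; exists 0; [exact: mem_ray0|rewrite addr0].
Qed.

End Rays.

(** * Vertices of a polytope and the cones at them *)

Section Vertices.
Context {R : realType} {d : nat}.
Local Notation W := 'rV[R]_d.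
Implicit Types (P : set W).

Lemma conv_hull_lift k (X : 'I_k.+1 -> W) (i : 'I_k.+1) :
  conv_hull (X \o lift i) (X i) -> conv_hull X = conv_hull (X \o lift i).
Proof.
move=> [m [m0 m1 XiE]]; apply/seteqP; split => _ [l [l0 l1 ->]].
  (* The weight of the redundant point [X i] is spread over the other points along its own
     coefficients [m]. *)
  exists (fun j => l i * m j + l (lift i j)); split => [j||].
  - by rewrite addr_ge0// mulr_ge0.
  - by rewrite big_split/= -mulr_sumr m1 mulr1 -l1 (bigD1_ord i).
  - rewrite (bigD1_ord i)//= {1}XiE scaler_sumr -big_split/=.
    by apply: eq_bigr => j _; rewrite scalerDl scalerA.
exists (fun j => if unlift i j is Some j' then l j' else 0); split => [j||].
- by case: unlift.
- rewrite (bigD1_ord i)//= unlift_none add0r.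
  by under eq_bigr do rewrite liftK.
- rewrite (bigD1_ord i)//= unlift_none scale0r add0r.
  by under [RHS]eq_bigr do rewrite liftK.
Qed.

Lemma irredundant_vertex k (X : 'I_k.+1 -> W) (i : 'I_k.+1) :
  ~ conv_hull (X \o lift i) (X i) -> vertex (conv_hull X) (X i).
Proof.
(* The hull of the other points is cut out by finitely many inequalities; one that [X i] violates
   separates it from them. *)
have [s sE] : polyhedral (conv_hull (X \o lift i)).
  by apply: polytope_polyhedral; exists k, (X \o lift i).
rewrite {1}sE => /existsNP[h /not_implyP[hs /negP]]; rewrite -ltNge => hi.
have hj j : dotv h.1 (X (lift i j)) < dotv h.1 (X i).
  apply: le_lt_trans hi; move: (conv_hull_gen (X \o lift i) j); rewrite sE.
  exact.
(* The gap to the maximum is a sum of nonnegative terms with positive coefficients on the other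
   weights, so it is zero only at [X i]. *)
have gapE (l : 'I_k.+1 -> R) : \sum_j l j = 1 ->
    dotv h.1 (X i) - dotv h.1 (\sum_j l j *: X j) =
    \sum_j l (lift i j) * (dotv h.1 (X i) - dotv h.1 (X (lift i j))).
  move=> l1; rewrite dotv_sum -[X in X - _]mul1r -l1 mulr_suml -sumrB.
  rewrite (bigD1_ord i)//= subrr add0r.
  by apply: eq_bigr => j _; rewrite mulrBr.
have gap_ge0 (l : 'I_k.+1 -> R) j : (forall j, 0 <= l j) ->
    0 <= l (lift i j) * (dotv h.1 (X i) - dotv h.1 (X (lift i j))).
  by move=> l0; rewrite mulr_ge0// subr_ge0 ltW.
exists h.1, (dotv h.1 (X i)); split.
  move=> _ [l [l0 l1 ->]]; rewrite -subr_ge0 gapE//.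
  by apply: sumr_ge0 => j _; exact: gap_ge0.
apply/seteqP; split => x /=; first by move=> ->; split => //; exact: conv_hull_gen.
move=> [[l [l0 l1 ->]] /eqP]; rewrite eq_sym -subr_eq0 gapE// psumr_eq0; last first.
  by move=> j _; exact: gap_ge0.
move=> /allP lz.
have {}lz j : l (lift i j) = 0.
  have := lz j (mem_index_enum j); rewrite mulf_eq0 => /orP[/eqP//|].
  by rewrite subr_eq0 gt_eqF.
have li : l i = 1.
  by rewrite -l1 (bigD1_ord i)//= big1 ?addr0.
rewrite (bigD1_ord i)//= li scale1r big1 ?addr0// => j _.
by rewrite lz scale0r.
Qed.

(** Redundant generators are discarded one at a time; once none is left, all are vertices. *)
Lemma polytope_vertices P : polytope P ->
  exists k (X : 'I_k -> W), P = conv_hull X /\ forall i, vertex P (X i).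
Proof.
move=> [n]; elim: n P => [|k IH] P [X PE].
  by exists 0%N, X; split => // -[].
have [[i Xi]|irr] := pselect (exists i, conv_hull (X \o lift i) (X i)).
  by apply: IH; exists (X \o lift i); rewrite PE; exact: conv_hull_lift.
exists k.+1, X; split => // i; rewrite PE; apply: irredundant_vertex => Xi.
by apply: irr; exists i.
Qed.

(** The cone at [X i] contains every [f - X i] with [f] in the hull and is closed under addition, so
    [F] may be shrunk to [X i]. It is applied both to a face and to the whole polytope. *)
Lemma polyind_face_cone k (X : 'I_k -> W) (F : set W) (i : 'I_k) :
  polyhedral F -> F `<=` conv_hull X -> F (X i) ->
  polyind F * \prod_j polyind (ray (X j - X i)) =
  polyind [set X i] * \prod_j polyind (ray (X j - X i)).
Proof.
move=> pF FX Fi.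
have pi : polyhedral [set X i].
  rewrite (_ : [set X i] = [set x | forall j, dotv (delta_mx 0 j) x = X i 0 j]).
    by apply: polyhedral_all => j; exact: polyhedral_hyperplane.
  apply/seteqP; split => x /=; first by move=> -> j; rewrite dotv_delta.
  by move=> xi; apply/rowP => j; rewrite -xi dotv_delta.
rewrite -(big_map (fun j => X j - X i) xpredT (fun u => polyind (ray u))).
rewrite polyind_cone !polyindM//; try exact: polyhedral_cone.
congr polyind; apply/seteqP; split => x; last first.
  by move=> [_ -> [y Ky <-]]; exists (X i) => //; exists y.
move=> [f Ff [y Ky <-]]; exists (X i) => //.
exists (f - X i + y); last by rewrite addrA subrKC.
apply: coneD => //.
have [l [l0 l1 ->]] := FX f Ff.
rewrite (_ : _ - _ = \sum_j l j *: (X j - X i)); first exact: cone_sum.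
under [RHS]eq_bigr do rewrite scalerBr.
by rewrite sumrB -scaler_suml l1 scale1r.
Qed.

End Vertices.

(** * The identities of vertex covers *)

Lemma vertex_cover_ID (R : realType) (d : nat) (P : set 'rV[R]_d)
    (C : set (set 'rV[R]_d)) :
  polytope P -> P !=set0 -> vertex_covers P C -> ID P C.
Proof.
move=> polP P0 [CP Cv].
have [k [X [PE vX]]] := polytope_vertices _ polP.
have pP := polytope_polyhedral polP.
(* Finiteness ensures that [fset_set C] has the elements of [C], so that the factor of a given face
   can be extracted below. *)
have finC : finite_set C := sub_finite_set CP (proper_faces_finite polP).
apply: (@total_preorder_annihilator _ _
  (fun i j => polyind (ray (X j - X i))) (enum 'I_k)).
- by move=> i; rewrite subrr ray_zero.
- by move=> i j; rewrite -(opprB (X j)) ray_opp.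
- move=> i j l; rewrite -[X l - X i](_ : X j - X i + (X l - X j) = _).
    exact: ray_trans.
  by rewrite addrC subrKA.
- apply/eqP => e; case: P0 => x; rewrite PE => -[l [_ l1 _]].
  move: l1; rewrite -big_enum e big_nil => /eqP.
  by rewrite eq_sym oner_eq0.
(* Multiplied by the class of the cone at [X i], both terms of the factor of [F] become the class of
   that cone translated to [X i], and they cancel. *)
move=> i _; have [F CF Fi] := Cv _ (vX i).
have [fF _ _] := CP _ CF.
have FP : F `<=` P by case: fF => c [b [_ ->]] x [].
rewrite (big_rem F) /=; last by rewrite in_fset_set ?inE.
rewrite mulrAC mulrBl big_enum/= !polyind_face_cone ?subrr ?mul0r// -?PE//.
- exact: face_polyhedral fF.
- by apply: FP.
Qed.

(** This excludes the empty polytope, whose empty cover has product 1. The base point [x0] is an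
    affine combination with weights of sum 1, hence of at least one point of [P]. *)
Lemma has_dim_nonempty (R : realType) (d k : nat) (P : set 'rV[R]_d) :
  has_dim P k -> P !=set0.
Proof.
move=> [x0 [U [PU _]]].
have : affine_hull P x0 by rewrite PU /= subrr mem0v.
move=> [[|m] [X [l [PX l1 _]]]]; last by exists (X ord0).
by move: l1; rewrite big_ord0 => /eqP; rewrite eq_sym oner_eq0.
Qed.

Theorem corollary4p13 (R : realType) (d : nat) (P : set 'rV[R]_d) :
  dim_polytope d P ->
  (forall C : set (set 'rV[R]_d), mvc_minimal P C -> ID P C) ->
  forall C : set (set 'rV[R]_d), vertex_covers P C -> ID P C.
Proof.
move=> [polP /has_dim_nonempty P0] _ C; exact: vertex_cover_ID.
Qed.
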